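(* Let $F\subset[0,1]$ be a closed nowhere dense set such that every point of $\{0,1\}\cap F$ (if this set is nonempty) is an accumulation point of $F$. Then there exists a function $f\in C^\infty[0,1]$ with $E(f)=F$.
   Context: A function $f\colon[0,1]\to\mathbb{R}$ cuts the real axis at a point $x\in[0,1]$ if $f(x)=0$ and in every neighbourhood $U$ of $x$ (in $[0,1]$) there exist $y,z\in U$ such that $f(y)<0<f(z)$. The cutting set $E(f)$ is the set of all $x\in[0,1]$ at which $f$ cuts the real axis. $C^\infty[0,1]$ is the space of functions $f\colon[0,1]\to\mathbb{R}$ having derivatives of all orders on $[0,1]$ (one-sided at the endpoints $0$ and $1$). *)

(* Defs.v *)
From HB Require Import structures.
From mathcomp Require Import all_boot all_order all_algebra.
From mathcomp Require Import all_classical all_reals all_analysis.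

Set Implicit Arguments.
Unset Strict Implicit.
Unset Printing Implicit Defensive.

Import Order.TTheory GRing.Theory Num.Theory.
Import numFieldNormedType.Exports.

Local Open Scope classical_set_scope.
Local Open Scope ring_scope.

(* A function [0, 1] -> R is represented by a function R -> R of which only
   the values on [0, 1] matter. *)

Definition nowhere_dense (T : topologicalType) (A : set T) : Prop :=
  interior (closure A) = set0.

(* Limits are taken over points y of D distinct from x: for D = [0, 1] this
   gives the one-sided derivatives at 0 and at 1. *)
Definition diff_quot (R : realType) (f : R -> R) (x y : R) : R :=
  (y - x)^-1 * (f y - f x).

Definition derivable_within (R : realType) (D : set R) (f : R -> R) (x : R)
  : Prop :=
  cvg (diff_quot f x y @[y --> within D x^']).

Definition derive_within (R : realType) (D : set R) (f : R -> R) (x : R) : R :=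
  lim (diff_quot f x y @[y --> within D x^']).

Definition derive_within_n (R : realType) (D : set R) (n : nat) (f : R -> R)
  : R -> R :=
  iter n (derive_within D) f.

Definition smooth01 (R : realType) (f : R -> R) : Prop :=
  forall (n : nat) (x : R), x \in `[0, 1] ->
    derivable_within `[0, 1]%classic (derive_within_n `[0, 1]%classic n f) x.

(* The neighbourhoods of x in [0, 1] are the traces U `&` `[0, 1] of the
   neighbourhoods U of x in R. *)
Definition cuts_at (R : realType) (f : R -> R) (x : R) : Prop :=
  f x = 0 /\
  forall U : set R, nbhs x U ->
    exists y z : R, [/\ (U `&` `[0, 1]%classic) y, (U `&` `[0, 1]%classic) z & f y < 0 < f z].

Definition cutting_set (R : realType) (f : R -> R) : set R :=
  [set x | x \in `[0, 1] /\ cuts_at f x].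

(* Main.v *)
(* Let A = F \/ {-1, 2}. On every gap ]p, q[ of A we put a bump that is positive
   near p, negative near q and zero in between. The bumps are all obtained from
   exp(-1/t) by translation only, so their n-th derivatives are bounded by
   K_n dist(., A)^2 with K_n independent of the gap; hence gluing them by 0 on A
   gives a smooth function f. Inside a gap f does not cut the axis, because it
   vanishes on a whole interval between the two signs. Conversely F is nowhere
   dense, so to the right of any point x < 1 of F there are points of gaps that
   start at or after x, hence positive values of f; symmetrically there are
   negative values to the left of any x > 0. At the endpoints 0 and 1 the missing
   sign is found near the points of F that accumulate there. *)
Require Import Defs.
From HB Require Import structures.
From mathcomp Require Import all_boot all_order all_algebra.
From mathcomp Require Import all_classical all_reals all_analysis.
From mathcomp Require Import ring lra.

Import Order.TTheory GRing.Theory Num.Theory.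
Import numFieldNormedType.Exports.

Local Open Scope classical_set_scope.
Local Open Scope ring_scope.

(** * Flat functions built from exp(-1/t) *)

(** The difference quotient is at most [K * |h|]. This serves where no single formula holds around
    the point: for [flat] at 0 and for [saw] on [A]. *)
Lemma is_derive_quadratic (R : realType) (f : R -> R) (x K : R) :
  f x = 0 -> (\forall y \near x, `|f y| <= K * (y - x) ^+ 2) ->
  is_derive x 1 f 0.
Proof.
move=> fx0 fK.
suff H : h^-1 *: (f (h *: (1 : R) + x) - f x) @[h --> 0^'] --> (0 : R).
  by apply: DeriveDef; [apply/cvg_ex; exists 0 | exact: cvg_lim H].
have /nbhs_ballP[d /= d0 dK] := fK.
apply: (@cvg_to_0_linear R _ K d) => // h /andP[h0 hd].
rewrite fx0 subr0 /GRing.scale/= mulr1 normrM normfV.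
rewrite mulrC ler_pdivrMr //.
have := dK (h + x); rewrite addrK -mulrA -expr2 real_normK ?num_real//.
by apply; rewrite /ball/= opprD addrCA subrr addr0 normrN.
Qed.

(** For [u >= 0] the exponential dominates each term of its power series. *)
Lemma exp_mul_expRN_le (R : realType) (k : nat) (u : R) :
  0 <= u -> u ^+ k * expR (- u) <= k`!%:R.
Proof.
move=> u0; rewrite expRN ler_pdivrMr ?expR_gt0//.
case: k => [|k]; first by rewrite expr0 mul1r -expR0 ler_expR.
have F0 : 0 < (k.+1)`!%:R :> R by rewrite ltr0n fact_gt0.
rewrite mulrC -ler_pdivrMr//.
by apply: le_trans (@expR_ge1Dxn R u k u0); rewrite lerDr.
Qed.

(** Keeping the powers of 1/t makes the family stable, up to linear combinations, under
    differentiation. *)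
Definition flat {R : realType} (k : nat) (t : R) : R :=
  if 0 < t then t^-1 ^+ k * expR (- t^-1) else 0.

Lemma flat_gt0 (R : realType) (k : nat) (t : R) : 0 < t -> 0 < flat k t.
Proof. by move=> t0; rewrite /flat t0 mulr_gt0 ?expR_gt0 ?exprn_gt0 ?invr_gt0. Qed.

Lemma flat_le0 (R : realType) (k : nat) (t : R) : t <= 0 -> flat k t = 0.
Proof. by rewrite /flat leNgt => /negPf->. Qed.

Lemma flat_ge0 (R : realType) (k : nat) (t : R) : 0 <= flat k t.
Proof. by have [/(flat_le0 _ k)->|/flat_gt0/ltW] := leP t 0. Qed.

Lemma flat_le (R : realType) (k : nat) (t : R) : flat k t <= k`!%:R.
Proof.
rewrite /flat; case: ifPn => // t0.
by rewrite exp_mul_expRN_le// invr_ge0 ltW.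
Qed.

(** Two powers of 1/t are traded for a factor [t ^+ 2], which leaves the bounded function
    [flat k.+2]. *)
Lemma flat_le_sqr (R : realType) (k : nat) (s t : R) :
  0 <= s -> t <= s -> flat k t <= (k.+2)`!%:R * s ^+ 2.
Proof.
move=> s0 ts; have [t0|t0] := leP t 0.
  by rewrite flat_le0// mulr_ge0// sqr_ge0.
have -> : flat k t = flat k.+2 t * t ^+ 2.
  rewrite /flat t0 !exprS; have := lt0r_neq0 t0 => {}t0; field.
  by rewrite t0.
by rewrite ler_pM ?flat_ge0 ?sqr_ge0 ?flat_le// ler_sqr// nnegrE// ltW.
Qed.

Lemma is_derive_flat (R : realType) (k : nat) (t : R) :
  is_derive t 1 (flat k) (flat k.+2 t - k%:R * flat k.+1 t).
Proof.
have [t0|t0|->] := ltgtP t 0.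
- rewrite !flat_le0 ?(ltW t0)// mulr0 subr0.
  apply: (@near_eq_is_derive _ _ _ (cst 0)).
  near=> y; rewrite flat_le0//.
  by near: y; exact: lt_le_nbhsl.
- have tn0 := lt0r_neq0 t0.
  have e : \forall y \near t, y^-1 ^+ k * expR (- y^-1) = flat k y.
    near=> y; have y0 : 0 < y by near: y; exact: lt_nbhsr.
    by rewrite /flat y0.
  apply: (near_eq_is_derive e).
  rewrite /flat t0.
  have DV := @is_deriveV R id t 1 1 tn0 (is_derive_id t 1).
  have DX := @is_deriveX R R (fun y : R => y^-1) k t 1 _ DV.
  have DN : is_derive t 1 (fun y : R => - y^-1) (- (- (t ^+ 2)^-1 *: (1 : R))).
    exact: is_deriveN DV.
  have DE := is_derive1_comp (is_derive_expR _) DN.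
  rewrite exprfctE in DX.
  have DM : is_derive t 1 (fun y : R => y^-1 ^+ k * expR (- y^-1)) _ :=
    is_deriveM DX DE.
  apply: (is_derive_eq DM).
  rewrite /GRing.scale/= !mulr1.
  case: k {e DX DE DM} => [|k]; rewrite ?mul0rn ?exprS /=.
    by rewrite /=; field.
  by rewrite -mulr_natl; field.
- rewrite !flat_le0// mulr0 subr0.
  apply: (@is_derive_quadratic _ _ _ (k.+2)`!%:R); first by rewrite flat_le0.
  near=> y; rewrite subr0 ger0_norm ?flat_ge0// -(real_normK (num_real y)).
  by rewrite flat_le_sqr// ler_norm.
Unshelve. all: by end_near.
Qed.

(** * Bumps with bounds uniform in the gap *)

(* [bump n 0 0 p q] is the [n]-th derivative of [flat 0 (x - p) * flat 0 (q - x)];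
   the indices [i], [j] follow the orders produced by [is_derive_flat]. *)
Fixpoint bump {R : realType} (n i j : nat) (p q x : R) : R :=
  if n is m.+1 then
    (bump m i.+2 j p q x - i%:R * bump m i.+1 j p q x) -
    (bump m i j.+2 p q x - j%:R * bump m i j.+1 p q x)
  else flat i (x - p) * flat j (q - x).

Lemma is_derive_bump (R : realType) (n i j : nat) (p q x : R) :
  is_derive x 1 (bump n i j p q) (bump n.+1 i j p q x).
Proof.
elim: n i j => [|n IH] i j; last first.
  have H1 := is_deriveB (IH i.+2 j) (is_deriveZ i%:R (IH i.+1 j)).
  have H2 := is_deriveB (IH i j.+2) (is_deriveZ j%:R (IH i j.+1)).
  exact: is_deriveB H1 H2.
have Dl : is_derive x 1 (fun y => y - p) 1.
  have H := is_deriveB (is_derive_id x (1 : R)) (is_derive_cst p x (1 : R)).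
  by apply: (is_derive_eq H); rewrite subr0.
have Dr : is_derive x 1 (fun y => q - y) (-1).
  have H := is_deriveB (is_derive_cst q x (1 : R)) (is_derive_id x (1 : R)).
  by apply: (is_derive_eq H); rewrite add0r.
have H1 := is_derive1_comp (is_derive_flat _ i _) Dl.
have H2 := is_derive1_comp (is_derive_flat _ j _) Dr.
have H : is_derive x 1 (fun y => flat i (y - p) * flat j (q - y)) _ :=
  is_deriveM H1 H2.
by apply: (is_derive_eq H); rewrite /GRing.scale/=; ring.
Qed.

(** Being close to one end, or beyond it, makes one factor small while the other stays below a
    factorial, whatever [p] and [q] are. *)
Lemma bump_le_sqr (R : realType) (n i j : nat) :
  exists K : R, forall p q x s : R, 0 <= s -> x - p <= s \/ q - x <= s ->
    `|bump n i j p q x| <= K * s ^+ 2.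
Proof.
elim: n i j => [|n IH] i j.
  exists (i.+2`!%:R * j.+2`!%:R) => p q x s s0 ps.
  rewrite ger0_norm ?mulr_ge0 ?flat_ge0//=.
  have le_fact k : (k`! <= k.+2`!)%N by rewrite leq_fact// leqW.
  have [xs|xs] := ps.
    rewrite mulrAC ler_pM ?flat_ge0 ?flat_le_sqr//.
    by rewrite (le_trans (flat_le _ _ _))// ler_nat.
  rewrite -mulrA ler_pM ?flat_ge0 ?flat_le_sqr//.
  by rewrite (le_trans (flat_le _ _ _))// ler_nat.
have [[K1 H1] [K2 H2]] := (IH i.+2 j, IH i.+1 j).
have [[K3 H3] [K4 H4]] := (IH i j.+2, IH i j.+1).
exists (K1 + i%:R * K2 + (K3 + j%:R * K4)) => p q x s s0 ps /=.
rewrite !mulrDl -!mulrA.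
apply: le_trans (ler_normB _ _) _; apply: lerD;
  apply: le_trans (ler_normB _ _) _; apply: lerD; rewrite ?normrM ?normr_nat;
  by rewrite ?ler_wpM2l ?(H1, H2, H3, H4).
Qed.

(* Positive near [p], negative near [q] and zero in between, so that it changes
   sign without cutting the axis inside [`]p, q[]. *)
Definition double_bump {R : realType} (n : nat) (p q x : R) : R :=
  bump n 0 0 p ((2 * p + q) / 3) x - bump n 0 0 ((p + 2 * q) / 3) q x.

Lemma is_derive_double_bump (R : realType) (n : nat) (p q x : R) :
  is_derive x 1 (double_bump n p q) (double_bump n.+1 p q x).
Proof.
exact: is_deriveB (is_derive_bump _ _ _ _ _ _ _) (is_derive_bump _ _ _ _ _ _ _).
Qed.

Lemma double_bump_le_sqr (R : realType) (n : nat) :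
  exists K : R, forall p q x s : R, p <= q -> 0 <= s ->
    x - p <= s \/ q - x <= s -> `|double_bump n p q x| <= K * s ^+ 2.
Proof.
have [K HK] := @bump_le_sqr R n 0 0.
exists (K + K) => p q x s pq s0 ps; rewrite mulrDl.
apply: le_trans (ler_normB _ _) _.
(* Since [p <= q], the inner ends lie between [p] and [q], so the inequality at [p] or [q] carries
   over to both bumps. *)
by apply: lerD; apply: HK => //; case: ps => ?; [left|right|left|right]; lra.
Qed.

(** This range and that of [double_bump_le0] overlap in the middle third, so for [p < q] one weak
    sign holds around every point. *)
Lemma double_bump_ge0 (R : realType) (p q x : R) :
  x <= (p + 2 * q) / 3 -> 0 <= double_bump 0 p q x.
Proof.
move=> xq; rewrite /double_bump/= [X in _ - X * _]flat_le0 ?subr_le0//.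
by rewrite mul0r subr0 mulr_ge0 ?flat_ge0.
Qed.

Lemma double_bump_le0 (R : realType) (p q x : R) :
  (2 * p + q) / 3 <= x -> double_bump 0 p q x <= 0.
Proof.
move=> px; rewrite /double_bump/= [X in _ * X - _]flat_le0 ?subr_le0//.
by rewrite mulr0 mulr_ge0 ?flat_ge0.
Qed.

Lemma double_bump_gt0 (R : realType) (p q x : R) :
  p < x < (2 * p + q) / 3 -> 0 < double_bump 0 p q x.
Proof.
move=> /andP[px xq]; rewrite /double_bump/= [X in _ - X * _]flat_le0; last lra.
by rewrite mul0r subr0 mulr_gt0 ?flat_gt0// subr_gt0.
Qed.

Lemma double_bump_lt0 (R : realType) (p q x : R) :
  (p + 2 * q) / 3 < x < q -> double_bump 0 p q x < 0.
Proof.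
move=> /andP[px xq]; rewrite /double_bump/= [X in _ * X - _]flat_le0; last lra.
by rewrite mulr0 sub0r oppr_lt0 mulr_gt0 ?flat_gt0// subr_gt0.
Qed.

(** * One-sided derivatives on [0, 1] *)

(** The quotient uses only values at points of [D], so agreement on [D] suffices; no more is known
    of the iterated derivatives. *)
Lemma cvg_diff_quot (R : realType) (D : set R) (f g : R -> R) (x df : R) :
  D x -> {in D, f =1 g} -> is_derive x 1 g df ->
  diff_quot f x y @[y --> within D x^'] --> df.
Proof.
move=> Dx fg [dg gdf].
have /cvgrPdist_lt H : h^-1 *: (g (h *: (1 : R) + x) - g x) @[h --> 0^'] --> df.
  by rewrite -gdf; exact: dg.
apply/cvgrPdist_lt => e e0.
have /nbhs_ballP[d /= d0 Hd] := H _ e0.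
apply/nbhs_ballP; exists d => //= y xy yx Dy.
rewrite /diff_quot !fg ?inE//.
have := Hd (y - x); rewrite /GRing.scale/= mulr1 subrK; apply.
  by move: xy; rewrite /ball/= sub0r normrN distrC.
by rewrite subr_eq0.
Qed.

Lemma within_dnbhs01_proper (R : realType) (x : R) : x \in `[0, 1] ->
  ProperFilter (within `[0, 1]%classic x^').
Proof.
rewrite in_itv/= => /andP[x0 x1]; split; last exact: within_filter.
rewrite /within/= => /nbhs_ballP[d /= d0 Hd].
(* A step of at most 1/2 towards the farther end stays in [0, 1]. *)
pose h := Num.min (d / 2) (1 / 2).
have [hd h2] : h <= d / 2 /\ h <= 1 / 2 by rewrite !ge_min !lexx orbT.
have h0 : 0 < h by rewrite lt_min !divr_gt0.
have [x12|x12] := leP x (1 / 2).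
- apply: (Hd (x + h)); rewrite /ball/= ?in_itv/=.
  + by rewrite opprD addrA subrr sub0r normrN gtr0_norm//; lra.
  + by rewrite -subr_eq0 addrAC subrr add0r gt_eqF.
  + by apply/andP; split; lra.
- apply: (Hd (x - h)); rewrite /ball/= ?in_itv/=.
  + by rewrite subKr gtr0_norm//; lra.
  + by rewrite -subr_eq0 addrAC subrr add0r oppr_eq0 gt_eqF.
  + by apply/andP; split; lra.
Qed.

(** By induction [g n] is the n-th derivative on [0, 1], because limits along a proper filter are
    unique. *)
Lemma smooth01_is_derive (R : realType) (g : nat -> R -> R) :
  (forall (n : nat) (x : R), x \in `[0, 1] -> is_derive x 1 (g n) (g n.+1 x)) ->
  smooth01 (g 0%N).
Proof.
move=> dg.
have E n : {in `[0, 1]%classic, derive_within_n `[0, 1]%classic n (g 0%N) =1 g n}.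
  elim: n => [|n IH] x //; rewrite inE => x01.
  have PF := within_dnbhs01_proper _ _ x01.
  apply: cvg_lim => //; apply: cvg_diff_quot x01 IH (dg n x x01).
move=> n x x01; apply/cvg_ex; exists (g n.+1 x).
exact: cvg_diff_quot x01 (E n) (dg n x x01).
Qed.

(** * Gaps of a closed set *)

Definition gap_left {R : realType} (A : set R) (x : R) : R :=
  sup (A `&` [set y | y <= x]).

(** Defined by reflection, so that [gap_rightP] comes from [gap_leftP]. *)
Definition gap_right {R : realType} (A : set R) (x : R) : R :=
  - gap_left (-%R @` A) (- x).

Lemma gap_leftP (R : realType) (A : set R) (a x : R) :
  closed A -> A a -> a <= x ->
  [/\ A (gap_left A x), gap_left A x <= x &
      forall y, A y -> y <= x -> y <= gap_left A x].
Proof.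
move=> cA Aa ax; set E := A `&` [set y | y <= x].
have E0 : E !=set0 by exists a.
have ubE : ubound E x by move=> y [].
have [Al lx] : E (gap_left A x).
  have cE : closed E by apply: closedI => //; exact: closed_le.
  by rewrite ((closure_id _).1 cE); apply: closure_sup => //; exists x.
split=> // y Ay yx; apply: sup_upper_bound => //; split => //; by exists x.
Qed.

Lemma gap_rightP (R : realType) (A : set R) (b x : R) :
  closed A -> A b -> x <= b ->
  [/\ A (gap_right A x), x <= gap_right A x &
      forall y, A y -> x <= y -> gap_right A x <= y].
Proof.
move=> cA Ab xb.
have NAb : (-%R @` A) (- b) by exists b.
have := xb; rewrite -lerN2 => Nxb.
have [[z Az zE] lx lub] := gap_leftP _ _ _ _ (closedN cA) NAb Nxb.
rewrite /gap_right; split.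
- by rewrite -zE opprK.
- by rewrite lerNr.
- by move=> y Ay xy; rewrite lerNl lub ?lerN2//; exists y.
Qed.

(** * The glued function: smoothness and signs *)

(* At a point of [A] both ends of the gap degenerate to the point itself. *)
Definition saw {R : realType} (A : set R) (n : nat) (x : R) : R :=
  double_bump n (gap_left A x) (gap_right A x) x.

Section saw.
Context {R : realType} (A : set R) (a b : R).
Hypotheses (cA : closed A) (Aa : A a) (Ab : A b).

Lemma gap_end x : A x -> gap_left A x = x /\ gap_right A x = x.
Proof.
move=> Ax.
have [_ l1 l2] := gap_leftP _ _ _ _ cA Ax (lexx x).
have [_ r1 r2] := gap_rightP _ _ _ _ cA Ax (lexx x).
by split; apply/le_anti; rewrite ?l1 ?l2 ?r1 ?r2.
Qed.

Lemma gap_inner x : a < x < b -> ~ A x ->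
  [/\ A (gap_left A x), A (gap_right A x) &
      gap_left A x < x < gap_right A x].
Proof.
move=> /andP[ax xb] nAx.
have [Al l1 _] := gap_leftP _ _ _ _ cA Aa (ltW ax).
have [Ar r1 _] := gap_rightP _ _ _ _ cA Ab (ltW xb).
split=> //; rewrite !lt_neqAle l1 r1 !andbT; apply/andP; split.
  by apply: contra_notN nAx => /eqP <-.
by apply: contra_notN nAx => /eqP ->.
Qed.

(** The ends are constant on a gap: another end would be a point of [A] strictly between them. *)
Lemma saw_gap n x : a < x < b -> ~ A x ->
  {in `]gap_left A x, gap_right A x[, saw A n =1
    double_bump n (gap_left A x) (gap_right A x)}.
Proof.
move=> axb nAx y; rewrite in_itv/= => /andP[ly yr].
have [Al Ar /andP[lx xr]] := gap_inner _ axb nAx.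
have /andP[ax xb] := axb.
have [_ _ lmax] := gap_leftP _ _ _ _ cA Aa (ltW ax).
have [_ _ rmin] := gap_rightP _ _ _ _ cA Ab (ltW xb).
have [Aly l1 l2] := gap_leftP _ _ _ _ cA Al (ltW ly).
have [Ary r1 r2] := gap_rightP _ _ _ _ cA Ar (ltW yr).
rewrite /saw; congr double_bump; apply/le_anti/andP; split.
- have [/(lmax _ Aly)//|/ltW xly] := leP (gap_left A y) x.
  by have := rmin _ Aly xly; rewrite leNgt (le_lt_trans l1 yr).
- exact: l2 (ltW ly).
- exact: r2 (ltW yr).
- have [/(rmin _ Ary)//|/ltW xly] := leP x (gap_right A y).
  by have := lmax _ Ary xly; rewrite leNgt (lt_le_trans ly r1).
Qed.

(** The gap is degenerate at [x], so the quadratic bound applies with [s = 0]. *)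
Lemma saw_eq0 n x : A x -> saw A n x = 0.
Proof.
move=> /gap_end[lx rx]; rewrite /saw lx rx.
have [K /(_ x x x 0 (lexx _) (lexx _))] := @double_bump_le_sqr R n.
rewrite subrr expr0n/= mulr0 => /(_ (or_introl (lexx _))).
by rewrite normr_le0 => /eqP.
Qed.

(** Off [A] the function is locally one double bump. At [x] in [A], a gap end of any nearby [y] lies
    between [x] and [y], so the quadratic bound applies with [s = |y - x|]. *)
Lemma is_derive_saw n x : a < x < b ->
  is_derive x 1 (saw A n) (saw A n.+1 x).
Proof.
move=> axb; have [Ax|nAx] := pselect (A x); last first.
  have [_ _ xlr] := gap_inner _ axb nAx.
  apply: (@near_eq_is_derive _ _ _ (double_bump n (gap_left A x) (gap_right A x))).
    have : \forall y \near x, y \in `]gap_left A x, gap_right A x[.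
      exact: near_in_itvoo.
    by apply: filterS => y /(saw_gap n _ axb nAx).
  exact: is_derive_double_bump.
rewrite saw_eq0//.
have [K HK] := @double_bump_le_sqr R n.
apply: (@is_derive_quadratic _ _ _ K); first exact: saw_eq0.
have : \forall y \near x, y \in `]a, b[ by exact: near_in_itvoo.
apply: filterS => y; rewrite in_itv/= => /andP[/ltW ay /ltW yb].
have [_ l1 l2] := gap_leftP _ _ _ _ cA Aa ay.
have [_ r1 r2] := gap_rightP _ _ _ _ cA Ab yb.
rewrite -(real_normK (num_real (y - x))); apply: HK => //.
  exact: le_trans r1.
have [xy|/ltW yx] := leP x y.
  by left; rewrite ger0_norm ?subr_ge0// lerB// l2.
by right; rewrite ler0_norm ?subr_le0// opprB lerB// r2.
Qed.

Lemma saw_nocut x : a < x < b -> ~ A x ->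
  (\forall y \near x, 0 <= saw A 0 y) \/ (\forall y \near x, saw A 0 y <= 0).
Proof.
move=> axb nAx; have [_ _ xlr] := gap_inner _ axb nAx.
have near_gap : \forall y \near x, y \in `]gap_left A x, gap_right A x[.
  exact: near_in_itvoo.
set p := gap_left A x in xlr near_gap *; set q := gap_right A x in xlr near_gap *.
have [xq|xq] := ltP x ((p + 2 * q) / 3).
  left; near=> y; rewrite (saw_gap _ _ axb nAx); last by near: y.
  apply: double_bump_ge0; near: y; exact: lt_le_nbhsl.
right; near=> y; rewrite (saw_gap _ _ axb nAx); last by near: y.
apply: double_bump_le0; near: y; apply: lt_le_nbhsr.
by move: xlr xq => /andP[]; rewrite -/p -/q; lra.
Unshelve. all: by end_near.
Qed.

(** As [x] is in [A], the gap of [t] starts at or after [x], and the bump is positive just after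
    that start. *)
Lemma saw_pos x t : A x -> x < t -> t < b -> a < t -> ~ A t ->
  exists2 y, x < y < t & 0 < saw A 0 y.
Proof.
move=> Ax xt tb at_ nAt; have atb : a < t < b by rewrite at_.
have [_ _ /andP[lt tr]] := gap_inner _ atb nAt.
have [_ _ /(_ x Ax (ltW xt)) xl] := gap_leftP _ _ _ _ cA Aa (ltW at_).
set p := gap_left A t in lt xl; set q := gap_right A t in tr.
(* The midpoint of [p] and [m] lies before [t] and inside the first third of the gap. *)
pose m := Num.min t ((2 * p + q) / 3).
have pm : p < m by rewrite lt_min lt; lra.
have [mt mq] : m <= t /\ m <= (2 * p + q) / 3 by rewrite !ge_min !lexx orbT.
exists ((p + m) / 2); first by apply/andP; split; lra.
rewrite (saw_gap _ _ atb nAt) ?in_itv/= -/p -/q; last by apply/andP; split; lra.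
by apply: double_bump_gt0; apply/andP; split; lra.
Qed.

(** Mirror image of [saw_pos]: the gap of [t] ends at or before [x]. *)
Lemma saw_neg x t : A x -> t < x -> t < b -> a < t -> ~ A t ->
  exists2 y, t < y < x & saw A 0 y < 0.
Proof.
move=> Ax xt tb at_ nAt; have atb : a < t < b by rewrite at_.
have [_ _ /andP[lt tr]] := gap_inner _ atb nAt.
have [_ _ /(_ x Ax (ltW xt)) xl] := gap_rightP _ _ _ _ cA Ab (ltW tb).
set p := gap_left A t in lt; set q := gap_right A t in tr xl.
pose m := Num.max t ((p + 2 * q) / 3).
have pm : m < q by rewrite gt_max tr; lra.
have [mt mq] : t <= m /\ (p + 2 * q) / 3 <= m by rewrite !le_max !lexx orbT.
exists ((q + m) / 2); first by apply/andP; split; lra.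
rewrite (saw_gap _ _ atb nAt) ?in_itv/= -/p -/q; last by apply/andP; split; lra.
by apply: double_bump_lt0; apply/andP; split; lra.
Qed.

End saw.

(** * Construction for a nowhere dense set *)

Lemma nowhere_dense_itv (R : realType) (F : set R) (u v : R) :
  nowhere_dense F -> u < v -> exists2 t, u < t < v & ~ F t.
Proof.
move=> nF uv; apply: contrapT => H.
suff : interior (closure F) ((u + v) / 2) by rewrite nF.
have : \forall y \near (u + v) / 2, y \in `]u, v[.
  by apply: near_in_itvoo; rewrite in_itv/=; apply/andP; split; lra.
apply: filterS => y; rewrite in_itv/= => yuv; apply: subset_closure.
by apply: contrapT => nFy; apply: H; exists y.
Qed.

Theorem theorem4p1 (R : realType) (F : set R)
    (F01 : F `<=` `[0, 1]%classic)
    (closedF : closed F)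
    (nwdF : nowhere_dense F)
    (endF : [set 0; 1] `&` F `<=` limit_point F) :
  exists f : R -> R, smooth01 f /\ cutting_set f = F.
Proof.
(* The points -1 and 2 close the outer gaps and leave 0 and 1 inside []-1, 2[], where two-sided
   derivatives exist. *)
pose A : set R := F `|` [set -1; 2].
have cA : closed A.
  by apply: closedU => //; apply: closedU; exact: closed_eq.
have Aa : A (-1) by right; left.
have Ab : A 2 by right; right.
have AF x : x \in `[0, 1] -> A x -> F x.
  by rewrite in_itv/= => /andP[x0 x1] [//|[]/= xE]; exfalso; lra.
have in12 (x : R) : x \in `[0, 1] -> -1 < x < 2.
  by rewrite in_itv/= => /andP[x0 x1]; apply/andP; split; lra.
have Fin x : F x -> 0 <= x <= 1 by move=> /F01; rewrite /= in_itv.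
have pos x e : F x -> x < 1 -> 0 < e ->
    exists2 y, x < y < x + e & 0 <= y <= 1 /\ 0 < saw A 0 y.
  move=> Fx x1 e0; have /andP[x0 _] := Fin x Fx.
  (* The cap at 1 keeps [t] in [0, 1], where lying outside [F] means lying outside [A]. *)
  have [|t] := @nowhere_dense_itv R F x (Num.min (x + e) 1) nwdF.
    by rewrite lt_min x1 ltrDl e0.
  rewrite lt_min => /and3P[xt te t1] nFt.
  have t01 : t \in `[0, 1] by rewrite in_itv/=; apply/andP; split; lra.
  have [] := @saw_pos R A (-1) 2 cA Aa Ab x t _ xt; rewrite ?(in12 t)//.
  - by left.
  - lra.
  - lra.
  - by move=> /(AF _ t01).
  move=> y /andP[xy yt] y0; exists y; first by apply/andP; split; lra.
  by split => //; apply/andP; split; lra.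
have neg x e : F x -> 0 < x -> 0 < e ->
    exists2 y, x - e < y < x & 0 <= y <= 1 /\ saw A 0 y < 0.
  move=> Fx x0 e0; have /andP[_ x1] := Fin x Fx.
  have [|t] := @nowhere_dense_itv R F (Num.max (x - e) 0) x nwdF.
    by rewrite gt_max x0 andbT; lra.
  rewrite gt_max => /andP[/andP[te t0] tx] nFt.
  have t01 : t \in `[0, 1] by rewrite in_itv/=; apply/andP; split; lra.
  have [] := @saw_neg R A (-1) 2 cA Aa Ab x t _ tx; rewrite ?(in12 t)//.
  - by left.
  - lra.
  - lra.
  - by move=> /(AF _ t01).
  move=> y /andP[xy yt] y0; exists y; first by apply/andP; split; lra.
  by split => //; apply/andP; split; lra.
have lim01 x e : (x = 0 \/ x = 1) -> F x -> 0 < e ->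
    exists2 z, F z & z != x /\ `|x - z| < e.
  move=> x01 Fx e0; have xl : limit_point F x by apply: endF; split.
  by have [z [zx Fz xz]] := xl _ (nbhsx_ballx x e e0); exists z.
exists (saw A 0); split.
  apply: (@smooth01_is_derive R (saw A)) => n x x01.
  exact: (@is_derive_saw R A (-1) 2 cA Aa Ab n x (in12 x x01)).
apply/seteqP; split => x /=.
  (* Around a point outside [F] the function keeps a weak sign, against one of the two strict signs
     of a cut. *)
  move=> [x01 [_ cutx]]; apply: contrapT => nFx.
  have nAx : ~ A x by move=> /(AF _ x01).
  have [/cutx|/cutx] := @saw_nocut R A (-1) 2 cA Aa Ab x (in12 x x01) nAx.
    by move=> [y [z [[/= + _] _ /andP[+ _]]]]; rewrite leNgt => /negP.
  by move=> [y [z [_ [/= + _] /andP[_ +]]]]; rewrite leNgt => /negP.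
move=> Fx; have /andP[x0 x1] := Fin x Fx.
split; first by rewrite in_itv/= x0.
split; first by apply: (@saw_eq0 R A cA); left.
move=> U /nbhs_ballP[e /= e0 eU].
have [y xy [y01 fy]] : exists2 y, `|x - y| < e & 0 <= y <= 1 /\ saw A 0 y < 0.
  have [x_le0|x_gt0] := leP x 0; last first.
    have [y /andP[xy yx] fy] := neg x e Fx x_gt0 e0.
    by exists y => //; rewrite gtr0_norm; lra.
  have xE : x = 0 by lra.
  (* At 0 the negative value is sought to the left of a point [w] of [F] with [0 < w < e]; radius
     [w] keeps it in []0, w[]. *)
  have [w Fw [wx]] := lim01 x e (or_introl xE) Fx e0.
  have /andP[w0 _] := Fin w Fw.
  have {}w0 : 0 < w by rewrite lt_neqAle w0 andbT eq_sym -xE.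
  rewrite xE sub0r normrN gtr0_norm// => we.
  have [y /andP[wy yw] fy] := neg w w Fw w0 w0.
  by exists y => //; rewrite sub0r normrN gtr0_norm; lra.
have [z xz [z01 fz]] : exists2 z, `|x - z| < e & 0 <= z <= 1 /\ 0 < saw A 0 z.
  have [x_ge1|x_lt1] := leP 1 x; last first.
    have [z /andP[xz zx] fz] := pos x e Fx x_lt1 e0.
    by exists z => //; rewrite ltr0_norm; lra.
  have xE : x = 1 by lra.
  (* Symmetrically at 1, radius [1 - w] keeps the positive value in []w, 1[]. *)
  have [w Fw [wx]] := lim01 x e (or_intror xE) Fx e0.
  have /andP[_ w1] := Fin w Fw.
  have {}w1 : w < 1 by rewrite lt_neqAle w1 andbT -xE.
  rewrite xE gtr0_norm ?subr_gt0// => we.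
  have e1 : 0 < 1 - w by rewrite subr_gt0.
  have [z /andP[wz zw] fz] := pos w (1 - w) Fw w1 e1.
  by exists z => //; rewrite gtr0_norm; lra.
exists y, z; split; last by rewrite fy fz.
- by split; [exact: eU | rewrite /= in_itv].
- by split; [exact: eU | rewrite /= in_itv].
Qed.
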